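(* Let $G$ and $H$ be connected graphs, each with at least one edge, such that $\chi(G)\ge\chi(H)$ and $\mathrm{tw}(G)\ge 2^{4\chi(G)^4}$. Then $\chi(G\,\square\,H)\le \eta(G\,\square\,H)$ (that is, Hadwiger's Conjecture holds for $G\,\square\,H$).
   Context: All graphs are finite, simple and undirected. $\chi$ denotes chromatic number, $\mathrm{tw}$ treewidth, and $\eta(G)$ is the maximum $k$ such that $K_k$ is a minor of $G$. The Cartesian product $G\,\square\,H$ has vertex set $V(G)\times V(H)$, with $(v,x)(w,y)$ an edge iff ($vw\in E(G)$ and $x=y$) or ($v=w$ and $xy\in E(H)$). *)

(* Defs.v *)
(* Mathematical Components, with classical decidability of propositions for
   treewidth only. *)
From mathcomp Require Import all_boot.
From mathcomp Require Import boolp.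

Set Implicit Arguments.
Unset Strict Implicit.
Unset Printing Implicit Defensive.

Record sgraph := SGraph {
  vertex :> finType;
  edge : rel vertex;
  edge_sym : symmetric edge;
  edge_irrefl : irreflexive edge }.

Arguments edge {s} x y : rename.

Lemma complete_sym (k : nat) : symmetric (fun x y : 'I_k => x != y).
Proof. by move=> x y; rewrite eq_sym. Qed.

Lemma complete_irrefl (k : nat) : irreflexive (fun x y : 'I_k => x != y).
Proof. by move=> x; rewrite eqxx. Qed.

Definition complete (k : nat) : sgraph :=
  SGraph (@complete_sym k) (@complete_irrefl k).

Definition cart_edge (G H : sgraph) : rel (G * H) :=
  fun p q => (edge p.1 q.1 && (p.2 == q.2)) || ((p.1 == q.1) && edge p.2 q.2).

Lemma cart_edge_sym (G H : sgraph) : symmetric (@cart_edge G H).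
Proof.
move=> p q; rewrite /cart_edge (edge_sym p.1) (edge_sym p.2).
by rewrite (eq_sym p.1) (eq_sym p.2).
Qed.

Lemma cart_edge_irrefl (G H : sgraph) : irreflexive (@cart_edge G H).
Proof. by move=> p; rewrite /cart_edge !edge_irrefl andbF. Qed.

Definition cart_prod (G H : sgraph) : sgraph :=
  SGraph (@cart_edge_sym G H) (@cart_edge_irrefl G H).

(* The subgraph induced by A is connected; connected graphs are nonempty. *)
Definition connected_set (G : sgraph) (A : {set G}) : bool :=
  (A != set0) &&
  [forall x in A, forall y in A,
     connect (fun u v : G => [&& u \in A, v \in A & edge u v]) x y].

Definition connected (G : sgraph) : bool := connected_set [set: G].

Definition colorable (G : sgraph) (k : nat) : bool :=
  [exists f : {ffun G -> 'I_k},
     [forall x, forall y, edge x y ==> (f x != f y)]].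

Lemma colorable_exists (G : sgraph) : exists k, colorable G k.
Proof.
exists #|G|; apply/existsP; exists [ffun x => enum_rank x].
apply/forallP=> x; apply/forallP=> y; apply/implyP=> exy.
rewrite !ffunE (inj_eq enum_rank_inj).
by apply: contraTneq exy => ->; rewrite edge_irrefl.
Qed.

Definition chromatic_number (G : sgraph) : nat := ex_minn (colorable_exists G).

(* M is a model of H in G: its values are the branch sets, which are contracted
   to the vertices of H. *)
Definition minor_model (H G : sgraph) (M : {ffun H -> {set G}}) : bool :=
  [&& [forall x, connected_set (M x)],
      [forall x, forall y, (x != y) ==> [disjoint M x & M y]] &
      [forall x, forall y, edge x y ==>
         [exists u in M x, exists v in M y, edge u v]]].

Definition minor (H G : sgraph) : bool :=
  [exists M : {ffun H -> {set G}}, minor_model M].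

Lemma complete_minor_exists (G : sgraph) : exists k, minor (complete k) G.
Proof.
exists 0; apply/existsP; exists [ffun=> set0].
by apply/and3P; split; apply/forallP=> -[].
Qed.

Lemma complete_minor_bound (G : sgraph) (k : nat) :
  minor (complete k) G -> k <= #|G|.
Proof.
case/existsP=> M /and3P[/forallP conM /forallP disM _].
have ex_r x : exists u, u \in M x by apply/set0Pn; case/andP: (conM x).
have inj_r : injective (fun x => xchoose (ex_r x)).
  move=> x y /= rxy; apply/eqP/negPn/negP => neq_xy.
  have disj := implyP (forallP (disM x) y) neq_xy.
  have := disjointFr disj (xchooseP (ex_r x)).
  by rewrite rxy (xchooseP (ex_r y)).
by have := leq_card _ inj_r; rewrite card_ord.
Qed.

Definition hadwiger_number (G : sgraph) : nat :=
  ex_maxn (complete_minor_exists G) (@complete_minor_bound G).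

(* ucycle also accepts the closed walk x, y, x along a single edge, which is
   not a cycle of a simple graph; hence the condition on the size. *)
Definition tree (T : sgraph) : Prop :=
  connected T /\ forall c : seq T, 2 < size c -> ~ ucycle edge c.

Definition tree_decomposition (G T : sgraph) (B : T -> {set G}) : Prop :=
  [/\ tree T,
      forall x : G, connected_set [set t | x \in B t] &
      forall x y : G, edge x y -> exists t, (x \in B t) && (y \in B t)].

(* Truncated at 0: this matters only for the graph with no vertices. *)
Definition width (G T : sgraph) (B : T -> {set G}) : nat :=
  (\max_(t : T) #|B t|).-1.

Definition has_decomposition_of_width (G : sgraph) (k : nat) : Prop :=
  exists (T : sgraph) (B : T -> {set G}), tree_decomposition B /\ width B = k.

Lemma decomposition_exists (G : sgraph) :
  exists k, `[< has_decomposition_of_width G k >].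
Proof.
pose B (t : complete 1) := [set: G].
exists (width B); apply/asboolP; exists (complete 1), B; split=> //.
have con1 (A : {set complete 1}) : ord0 \in A -> connected_set A.
  move=> A0; apply/andP; split; first by apply/set0Pn; exists ord0.
  apply/forall_inP=> s _; apply/forall_inP=> t _.
  by rewrite (ord1 s) (ord1 t) connect0.
split=> [|x|x y _].
- split=> [|c lt2c]; first by apply: con1; rewrite inE.
  case/andP=> _ /card_uniqP size_c.
  by have := max_card (mem c); rewrite size_c card_ord leqNgt (ltnW lt2c).
- by apply: con1; rewrite !inE.
by exists ord0; rewrite !inE.
Qed.

Definition treewidth (G : sgraph) : nat := ex_minn (decomposition_exists G).

(* Main.v *)
Require Import Defs.
From mathcomp Require Import all_boot.
From mathcomp Require Import zify boolp.

Set Implicit Arguments.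
Unset Strict Implicit.
Unset Printing Implicit Defensive.

(** Let [n] be the chromatic number of [G]. Adding colours modulo [n] shows that
    [G x H] is [n]-colourable, so a [K_n]-minor in [G x K_2] suffices. Put
    [k = (2n)^(n^2)]. As the treewidth of [G] exceeds [3nk], some vertex set [W] has
    no balanced separator of size [nk], and the connected sets containing more
    than half of [W] form a pairwise intersecting family without hitting set of
    size [nk]. Some path of [G] hits the whole family; it splits into [n] segments
    any two of which cannot be separated by fewer than [k] vertices. By Menger's
    theorem there are [k] disjoint connected sets joining the segments [i] and
    [j], for each [(i, j)]. Either one can choose one of them for each [(i, j)], all
    disjoint, or [n] of them from one linkage all intersect [n] of them from
    another. In both cases two families of disjoint connected sets, placed in
    the two copies of [G], give the minor. *)

(** * Menger's theorem *)

(** The relation [e] is not assumed symmetric: the induction for Menger's theorem deletes one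
    oriented edge at a time. *)
Definition linking (T : finType) (e : rel T) (A B : {set T}) (x : T) (p : seq T) :=
  [&& x \in A, path e x p & last x p \in B].

Definition separates (T : finType) (e : rel T) (A B S : {set T}) :=
  forall x p, linking e A B x p -> has (mem S) (x :: p).

Lemma path_to_first (T : finType) (e : rel T) (A P : {set T}) x y u p :
  x \in P -> u \in A -> path e u p -> has (mem P) (u :: p) ->
  exists2 q, linking [rel a b | e a b && ((a, b) != (x, y))] A P u q
           & {subset u :: q <= u :: p}.
Proof.
move=> Px Au; rewrite /linking Au /=.
suff main : forall v, path e v p -> has (mem P) (v :: p) ->
    exists2 q, path [rel a b | e a b && ((a, b) != (x, y))] v q
      && (last v q \in P) & {subset v :: q <= v :: p}.
  by move=> up hP; have [q qP sq] := main u up hP; exists q.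
elim: p => [|w p IHp] v /=.
  by move=> _; rewrite orbF => Pv; exists [::]; rewrite //= Pv.
case/andP=> evw wp; case: (boolP (v \in P)) => [Pv _ | nPv /= hP].
  by exists [::]; rewrite /= ?Pv // => z; rewrite !inE => ->.
have [q /andP[wq lq] sq] := IHp w wp hP.
exists (w :: q).
  rewrite /= evw wq lq /= !andbT xpair_eqE negb_and.
  by case: eqVneq nPv => // ->; rewrite Px.
by move=> z; rewrite inE => /predU1P[->|/sq zq]; rewrite in_cons ?eqxx // zq orbT.
Qed.

Lemma path_from_last (T : finType) (e : rel T) (Q B : {set T}) x y u p :
  y \in Q -> last u p \in B -> path e u p -> has (mem Q) (u :: p) ->
  exists v q, linking [rel a b | e a b && ((a, b) != (x, y))] Q B v q
           /\ {subset v :: q <= u :: p}.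
Proof.
move=> Qy; elim: p u => [|w p IHp] u lB.
  move=> _; rewrite has_seq1 => Qu; exists u, [::]; split=> //.
  exact/and3P.
move=> euwp; case: (boolP (has (mem Q) (w :: p))) => [hQ _ | nQ].
  case/andP: euwp => _ wp; have [v [q [vq sq]]] := IHp w lB wp hQ.
  by exists v, q; split=> // z /sq zq; rewrite in_cons zq orbT.
rewrite [has _ _]/= -/(has _ (w :: p)) (negPf nQ) orbF => Qu.
exists u, (w :: p); split=> //; apply/and3P; split=> //.
have ny : y \notin w :: p by apply: contra nQ => yp; apply/hasP; exists y.
elim: (w :: p) u euwp ny {lB nQ Qu IHp} => //= a q IHq u /andP[eua aq].
rewrite inE negb_or => /andP[ya yq]; rewrite eua xpair_eqE negb_and.
by rewrite (eq_sym a) ya orbT; apply: IHq.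
Qed.

(** Meant for the ends of [k] disjoint paths: they exhaust any set of at most [k] vertices that
    contains them. *)
Lemma inj_card_surj (T : finType) k (f : 'I_k -> T) (P : {set T}) :
  injective f -> (forall i, f i \in P) -> #|P| <= k ->
  forall v, v \in P -> exists i, f i = v.
Proof.
move=> fI fP leP v Pv.
have sub : [set f i | i : 'I_k] \subset P.
  by apply/subsetP=> _ /imsetP[i _ ->].
have : [set f i | i : 'I_k] == P by rewrite eqEcard sub card_imset // card_ord.
by move/eqP=> E; move: Pv; rewrite -E => /imsetP[i _ ->]; exists i.
Qed.

(* Goring's proof: delete an edge (x, y); if this creates a separator S with
   k - 1 vertices, then S + x and S + y are minimum separators, and the paths
   from A to S + x are joined to those from S + y to B, along (x, y). *)
Theorem menger (T : finType) (e : rel T) (A B : {set T}) (k : nat) :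
  (forall S, separates e A B S -> k <= #|S|) ->
  exists (a : 'I_k -> T) (p : 'I_k -> seq T),
    [/\ forall i, linking e A B (a i) (p i), forall i, uniq (a i :: p i)
      & forall i j z, z \in a i :: p i -> z \in a j :: p j -> i = j].
Proof.
have [m] := ubnP #|[set c | e c.1 c.2]|.
elim: m e A B => // m IHm e A B lem sepk.
case: (pickP [pred c | e c.1 c.2]) => [[x y] /= exy | noe]; last first.
  (* Without edges all paths are trivial, so [A :&: B] separates and its elements serve as the
     paths. *)
  have leAB : k <= #|A :&: B|.
    apply: sepk => x [|y p]; rewrite /linking /=; last first.
      by have /= -> := noe (x, y); rewrite andbF.
    by rewrite inE => ->.
  exists (fun i => enum_val (widen_ord leAB i)), (fun _ => [::]); split=> //.
  - move=> i; have := enum_valP (widen_ord leAB i); rewrite inE => /andP[Ai Bi].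
    by rewrite /linking Ai Bi.
  - move=> i j z; rewrite !inE => /eqP-> /eqP/enum_val_inj E.
    by apply: val_inj; have := congr1 val E.
pose e' := [rel a b | e a b && ((a, b) != (x, y))].
have e'e : subrel e' e by move=> a b /andP[].
have lte' : #|[set c | e' c.1 c.2]| < m.
  rewrite ltnS in lem; apply: leq_trans lem; apply/proper_card/properP; split.
    by apply/subsetP=> c; rewrite !inE => /andP[].
  by exists (x, y); rewrite !inE //= eqxx andbF.
have [sepk'|/existsNP[S /not_implyP[sepS ltS]]] :=
    pselect (forall S, separates e' A B S -> k <= #|S|).
  have [a [p [lp up dp]]] := IHm e' A B lte' sepk'.
  exists a, p; split=> // i; case/and3P: (lp i) => Aa pp Bl.
  by rewrite /linking Aa Bl (sub_path e'e).
have e'path a p : path e a p -> (x \in a :: p) && (y \in a :: p) || path e' a p.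
  elim: p a => [|b p IHp] a //=; first by rewrite orbT.
  case/andP=> eab /IHp /orP[/andP[xp yp]|e'p].
    by rewrite in_cons xp orbT in_cons yp orbT.
  rewrite eab e'p /= andbT; case: eqP => [[-> ->]|]; last by rewrite orbT.
  by rewrite !inE !eqxx !orbT.
have sepx z : (z == x) || (z == y) -> separates e A B (z |: S).
  move=> zxy a p /and3P[Aa ap Bl].
  case/orP: (e'path a p ap) => [/andP[xp yp]|e'p].
    apply/hasP; exists z; last by rewrite /= setU11.
    by case/orP: zxy => /eqP->.
  have := sepS a p; rewrite /linking Aa e'p Bl => /(_ isT).
  by apply: sub_has => w /= Sw; rewrite inE Sw orbT.
have kx := sepk _ (sepx x _); have ky := sepk _ (sepx y _).
rewrite !cardsU1 !eqxx ?orbT in kx ky.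
(* If [S] contained [x], it would already separate [A] from [B] in [e] with fewer than [k] vertices;
   likewise for [y]. *)
have xS : x \notin S by case: (x \notin S) (kx isT) => //; lia.
have yS : y \notin S by case: (y \notin S) (ky isT) => //; lia.
have cx : #|x |: S| <= k by rewrite cardsU1 xS; lia.
have cy : #|y |: S| <= k by rewrite cardsU1 yS; lia.
have [| a [p [lp up dp]]] := IHm e' A (x |: S) lte'.
  move=> R sepR; apply: sepk => a p /and3P[Aa ap Bl].
  have := sepx x _ a p; rewrite eqxx /linking Aa ap Bl => /(_ isT isT) hP.
  have [q lq sq] := path_to_first y (setU11 x S) Aa ap hP.
  have /hasP[z /sq zp Rz] := sepR _ _ lq.
  by apply/hasP; exists z.
have [| b [q [lq uq dq]]] := IHm e' (y |: S) B lte'.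
  move=> R sepR; apply: sepk => a' p' /and3P[Aa ap Bl].
  have := sepx y _ a' p'; rewrite eqxx orbT /linking Aa ap Bl => /(_ isT isT) hP.
  have [v [q' [lq sq]]] := path_from_last x (setU11 y S) Bl ap hP.
  have /hasP[z /sq zp Rz] := sepR _ _ lq.
  by apply/hasP; exists z.
(* The ends of the [k] disjoint paths fill [x |: S], so each path meets this set only in its end. *)
have lastP' i v : v \in a i :: p i -> v \in x |: S -> v = last (a i) (p i).
  move=> vi vP; have [||i' Ei'] := @inj_card_surj _ _ (fun i => last (a i) (p i)) _ _ _ cx v vP.
  - by move=> j j' /= E; apply: (dp _ _ (last (a j) (p j))); rewrite ?mem_last // E mem_last.
  - by move=> j; case/and3P: (lp j).
  by rewrite -Ei' (dp i' i v) // -Ei' mem_last.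
have headQ j v : v \in b j :: q j -> v \in y |: S -> v = b j.
  move=> vj vQ; have [||j' Ej'] := @inj_card_surj _ _ b _ _ _ cy v vQ.
  - by move=> i i' /= E; apply: (dq _ _ (b i)); rewrite ?mem_head // E mem_head.
  - by move=> i; case/and3P: (lq i).
  by rewrite -Ej' (dq j' j v) // -Ej' mem_head.
(* At a crossing outside [S], switching from one path to the other would give a path from [A] to [B]
   in [e'] that avoids [S]. *)
have meet i j z : z \in a i :: p i -> z \in b j :: q j ->
    [/\ z \in S, z = last (a i) (p i) & z = b j].
  move=> zi zj; case: (boolP (z \in S)) => [Sz|nSz].
    by split=> //; [apply: lastP' | apply: headQ] => //; rewrite inE Sz orbT.
  have [l1 [l2 [Ep El]]] : exists l1 l2, p i = l1 ++ l2 /\ last (a i) l1 = z.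
    by case/splitPl: zi => l1 l2 E; exists l1, l2.
  have [m1 [m2 [Eq Em]]] : exists m1 m2, q j = m1 ++ m2 /\ last (b j) m1 = z.
    by case/splitPl: zj => l1' l2' E; exists l1', l2'.
  case/and3P: (lp i) => Aa ap _; case/and3P: (lq j) => _ bq Bl.
  rewrite Ep cat_path in ap; rewrite Eq cat_path in bq.
  case/andP: ap => ap1 _; case/andP: bq => _ bq2.
  have := sepS (a i) (l1 ++ m2); rewrite /linking Aa cat_path ap1 El last_cat El.
  rewrite Em in bq2; rewrite bq2 -Em -last_cat -Eq Bl => /(_ isT)/hasP[w wl /= Sw].
  exfalso; have nzw : w != z by apply: contraNneq nSz => <-.
  rewrite -cat_cons mem_cat in wl; case/orP: wl => [wl1|wm2].
    have wi : w \in a i :: p i by rewrite Ep -cat_cons mem_cat wl1.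
    have Ew := lastP' i w wi; rewrite inE Sw orbT Ep last_cat El in Ew.
    have {}Ew := Ew isT.
    have := up i; rewrite Ep -cat_cons cat_uniq => /and3P[_ /hasPn nl _].
    have : w \in l2.
      by have := mem_last z l2; rewrite -Ew inE (negPf nzw).
    by move/nl; rewrite /= wl1.
  have wj : w \in b j :: q j by rewrite Eq -cat_cons mem_cat wm2 orbT.
  have Ew := headQ j w wj; rewrite inE Sw orbT in Ew; have {}Ew := Ew isT.
  have := uq j; rewrite Eq -cat_cons cat_uniq => /and3P[_ /hasPn nl _].
  by move/nl: wm2; rewrite /= Ew mem_head.
(* The path ending at [x] is continued by the one starting at [y], and any other path by the one
   starting at its own end in [S]. *)
have /choice[f fE] : forall i, exists j,
    b j = if last (a i) (p i) == x then y else last (a i) (p i).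
  move=> i; apply: (inj_card_surj _ _ cy).
  - by move=> j j' /= E; apply: (dq _ _ (b j)); rewrite ?mem_head // E mem_head.
  - by move=> j; case/and3P: (lq j).
  case: ifP => [_|nx]; first exact: setU11.
  by case/and3P: (lp i) => _ _; rewrite !inE nx => /= ->; rewrite orbT.
have fI : injective f.
  move=> i i' Ef; have := fE i; rewrite Ef fE.
  have yl j : last (a j) (p j) == y -> last (a j) (p j) == x.
    by case/and3P: (lp j) => _ _; rewrite !inE => /orP[->//|Sl] /eqP E; rewrite -E Sl in yS.
  have lI : last (a i) (p i) = last (a i') (p i') -> i = i'.
    by move=> E; apply: (dp _ _ (last (a i) (p i))); rewrite ?mem_last // E mem_last.
  case: ifP => [/eqP l'|l'x]; case: ifP => [/eqP l|lx].
  - by move=> _; apply: lI; rewrite l l'.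
  - by move=> E; move: (yl i); rewrite lx -E eqxx => /(_ isT).
  - by move=> E; move: (yl i'); rewrite l'x E eqxx => /(_ isT).
  - by move=> E; apply: lI.
(* When the two paths share a vertex of [S], that vertex must not be listed twice. *)
pose t i := if last (a i) (p i) == x then b (f i) :: q (f i) else q (f i).
have tq i z : z \in t i -> z \in b (f i) :: q (f i).
  by rewrite /t; case: ifP => // _ zq; rewrite inE zq orbT.
have tp i j z : z \in t i -> z \in a j :: p j -> i = j /\ z = b (f i).
  move=> zt zp; have [Sz Ez Eb] := meet j (f i) z zp (tq i z zt).
  split=> //; have := fE i; rewrite -Eb; case: ifP => [_ E|_ E].
    by rewrite -E Sz in yS.
  by apply: (dp _ _ z) => //; rewrite E mem_last.
exists a, (fun i => p i ++ t i); split.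
- move=> i; case/and3P: (lp i) => Aa ap _; case/and3P: (lq (f i)) => _ bq Bl.
  rewrite /linking Aa cat_path (sub_path e'e ap) last_cat /= /t.
  have := fE i; case: ifP => [/eqP->|_] Eb /=.
    by rewrite Bl (sub_path e'e bq) Eb exy.
  by rewrite -Eb Bl (sub_path e'e bq).
- move=> i; rewrite -/(uniq (a i :: p i ++ t i)) -cat_cons cat_uniq up /=; apply/andP; split.
    apply/hasPn=> z zt; apply/negP=> /= zp.
    have [_ Ez] := tp i i z zt zp.
    have := fE i; rewrite -Ez; move: zt; rewrite /t; case: ifP => [lx zt Ey|lx zt _].
      have [Sz _ _] := meet i (f i) z zp zt.
      by rewrite -Ey Sz in yS.
    by have := uq (f i); rewrite /= -Ez zt.
  by have := uq (f i); rewrite /t; case: ifP => //= _ /andP[].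
- move=> i j z; rewrite -!cat_cons !mem_cat => /orP[zi|zi] /orP[zj|zj].
  + exact: (dp _ _ z).
  + by case: (tp j i z zj zi).
  + by case: (tp i j z zi zj).
  + by apply: fI; apply: (dq _ _ z); apply: tq.
Qed.

(** * Connected sets and tree decompositions *)

(** Convertible to the relation inside [connected_set]. *)
Definition edge_in (G : sgraph) (A : {set G}) : rel G :=
  fun u v => [&& u \in A, v \in A & edge u v].

Lemma edge_in_sym (G : sgraph) (A : {set G}) : symmetric (edge_in A).
Proof. by move=> u v; rewrite /edge_in edge_sym andbCA. Qed.

Lemma connect_edge_in_sym (G : sgraph) (A : {set G}) : connect_sym (edge_in A).
Proof. exact/sym_connect_sym/edge_in_sym. Qed.

Lemma connect_edge_inS (G : sgraph) (A B : {set G}) x y :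
  A \subset B -> connect (edge_in A) x y -> connect (edge_in B) x y.
Proof.
move=> /subsetP sAB; apply: connect_sub => u v /and3P[uA vA euv].
by apply: connect1; rewrite /edge_in !sAB.
Qed.

Lemma connect_edge_in_mem (G : sgraph) (A : {set G}) x y :
  x \in A -> connect (edge_in A) x y -> y \in A.
Proof.
move=> xA /connectP[p pxp ->]; elim: p x xA pxp => //= z p IHp x xA.
by case/andP=> /and3P[_ zA _]; apply: IHp.
Qed.

Lemma path_edge_in (G : sgraph) (A : {set G}) x p :
  path (edge_in A) x p -> path edge x p /\ {subset p <= A}.
Proof.
elim: p x => [|y p IHp] x //= /andP[/and3P[xA yA exy] /IHp[yp sp]].
by rewrite exy yp; split=> // z; rewrite inE => /predU1P[->|/sp].
Qed.

Lemma connected_setP (G : sgraph) (A : {set G}) x :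
  x \in A -> (forall y, y \in A -> connect (edge_in A) x y) -> connected_set A.
Proof.
move=> xA con; apply/andP; split; first by apply/set0Pn; exists x.
apply/forall_inP=> y yA; apply/forall_inP=> z zA.
by apply: (connect_trans _ (con z zA)); rewrite connect_edge_in_sym con.
Qed.

Lemma connected_set_connect (G : sgraph) (A : {set G}) x y :
  connected_set A -> x \in A -> y \in A -> connect (edge_in A) x y.
Proof. by case/andP=> _ /forall_inP con xA yA; apply: (forall_inP (con x xA)). Qed.

Lemma connected_set_neq0 (G : sgraph) (A : {set G}) :
  connected_set A -> exists x, x \in A.
Proof. by case/andP=> /set0Pn. Qed.

Lemma connected_set1 (G : sgraph) (x : G) : connected_set [set x].
Proof.
by apply: (@connected_setP _ _ x) => [|y]; rewrite inE // => /eqP->; apply: connect0.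
Qed.

Lemma connected_setU (G : sgraph) (A B : {set G}) x :
  connected_set A -> connected_set B -> x \in A -> x \in B ->
  connected_set (A :|: B).
Proof.
move=> cA cB xA xB; apply: (@connected_setP _ _ x); first by rewrite inE xA.
move=> y; rewrite inE => /orP[yA|yB].
  exact: connect_edge_inS (subsetUl A B) (connected_set_connect cA xA yA).
exact: connect_edge_inS (subsetUr A B) (connected_set_connect cB xB yB).
Qed.

Lemma connected_setU1 (G : sgraph) (A : {set G}) x y :
  connected_set A -> x \in A -> edge x y -> connected_set (y |: A).
Proof.
move=> cA xA exy; apply: (@connected_setP _ _ x); first by rewrite inE xA orbT.
move=> z; rewrite !inE => /predU1P[->|zA].
  by apply: connect1; rewrite /edge_in !inE xA eqxx orbT.
exact: connect_edge_inS (subsetUr _ A) (connected_set_connect cA xA zA).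
Qed.

Lemma connected_set_imset (G K : sgraph) (f : G -> K) (A : {set G}) :
  (forall x y, edge x y -> edge (f x) (f y)) ->
  connected_set A -> connected_set (f @: A).
Proof.
move=> fe cA; have [x xA] := connected_set_neq0 cA.
apply: (@connected_setP _ _ (f x)); first exact: imset_f.
move=> _ /imsetP[y yA ->]; have := connected_set_connect cA xA yA.
case/connectP=> p pxp ->; elim: p x pxp {xA} => [|z p IHp] x /=.
  by rewrite connect0.
case/andP=> /and3P[xA zA exz] /IHp; apply: connect_trans.
by apply: connect1; rewrite /edge_in !imset_f ?fe.
Qed.

Lemma connected_set_path (G : sgraph) (x : G) p :
  path edge x p -> connected_set [set z in x :: p].
Proof.
elim: p x => [|y p IHp] x /=; first by rewrite set_seq1 connected_set1.
case/andP=> exy /IHp cp; rewrite set_cons.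
by apply: (@connected_setU1 _ _ y); rewrite ?inE ?eqxx // edge_sym.
Qed.

(** For [x] outside [A] this is the singleton of [x], as [connect] is reflexive. *)
Definition component (G : sgraph) (A : {set G}) x := [set y | connect (edge_in A) x y].

Lemma component_sub (G : sgraph) (A : {set G}) x :
  x \in A -> component A x \subset A.
Proof. by move=> xA; apply/subsetP=> y; rewrite inE; apply: connect_edge_in_mem. Qed.

Lemma mem_component (G : sgraph) (A : {set G}) x : x \in component A x.
Proof. by rewrite inE. Qed.

Lemma component_edge (G : sgraph) (A : {set G}) x y z :
  y \in component A x -> y \in A -> z \in A -> edge y z -> z \in component A x.
Proof.
rewrite !inE => cxy yA zA eyz; apply: connect_trans cxy _.
by apply: connect1; rewrite /edge_in yA zA.
Qed.

Lemma connected_component (G : sgraph) (A : {set G}) x :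
  connected_set (component A x).
Proof.
apply: (@connected_setP _ _ x); rewrite ?mem_component // => y; rewrite inE.
case/connectP=> p pxp ->; elim/last_ind: p pxp => [|p z IHp] /=.
  by rewrite connect0.
rewrite rcons_path last_rcons => /andP[pxp ez]; apply: connect_trans (IHp pxp) _.
have lC : last x p \in component A x by rewrite inE; apply/connectP; exists p.
apply: connect1; rewrite /edge_in lC /=; case/and3P: (ez) => lA zA e.
by rewrite e (component_edge lC).
Qed.

Lemma component_eq (G : sgraph) (A : {set G}) x y z :
  z \in component A x -> z \in component A y -> component A x = component A y.
Proof.
rewrite !inE => cxz cyz; apply/setP=> t; rewrite !inE.
have cxy : connect (edge_in A) x y.
  by apply: connect_trans cxz _; rewrite connect_edge_in_sym.
exact: (same_connect (@connect_edge_in_sym G A)).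
Qed.

Lemma connected_sub_edge_in (G : sgraph) (A B : {set G}) x y :
  A \subset B -> connected_set A -> x \in A -> y \in A -> connect (edge_in B) x y.
Proof. by move=> sAB cA xA yA; apply/(connect_edge_inS sAB)/connected_set_connect. Qed.

(** * Tree decompositions as lists of bags *)

Definition cover_seq (T : finType) (s : seq {set T}) : {set T} := \bigcup_(X <- s) X.

Lemma cover_seqP (G : finType) (s : seq {set G}) x :
  reflect (exists2 X, X \in s & x \in X) (x \in cover_seq s).
Proof.
rewrite /cover_seq; elim: s => [|X s IHs].
  by rewrite big_nil inE; constructor=> -[].
rewrite big_cons inE; apply: (iffP orP) => [[xX|/IHs[Y Ys xY]]|[Y]].
- by exists X; rewrite ?mem_head.
- by exists Y; rewrite ?inE ?Ys ?orbT.
- by rewrite inE => /predU1P[->|Ys xY]; [left | right; apply/IHs; exists Y].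
Qed.

Lemma cover_seq_cons (G : finType) (X : {set G}) s :
  cover_seq (X :: s) = X :|: cover_seq s.
Proof. exact: big_cons. Qed.

(* The bags of a tree decomposition, listed so that each one is a leaf when it
   is added (the running intersection property). *)
Inductive bag_list (G : finType) : seq {set G} -> Prop :=
| bag_list1 R : bag_list [:: R]
| bag_listS X Y s : bag_list s -> Y \in s -> X :&: cover_seq s \subset Y ->
    bag_list (X :: s).

Definition leaf_edge (T : sgraph) (t0 : T) : rel (option T) :=
  fun a b => match a, b with
  | Some s, Some t => edge s t
  | None, Some t | Some t, None => t == t0
  | None, None => false
  end.

Lemma leaf_edge_sym (T : sgraph) (t0 : T) : symmetric (leaf_edge t0).
Proof. by case=> [s|] [t|] //=; apply: edge_sym. Qed.

Lemma leaf_edge_irrefl (T : sgraph) (t0 : T) : irreflexive (leaf_edge t0).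
Proof. by case=> [s|] //=; apply: edge_irrefl. Qed.

Definition add_leaf (T : sgraph) (t0 : T) : sgraph :=
  SGraph (leaf_edge_sym t0) (leaf_edge_irrefl t0).

Lemma connected_Some (T : sgraph) (t0 : T) (A : {set T}) :
  connected_set A -> connected_set (Some @: A : {set add_leaf t0}).
Proof. exact: connected_set_imset. Qed.

Lemma connected_None (T : sgraph) (t0 : T) (A : {set T}) :
  t0 \in A -> connected_set A ->
  connected_set (None |: Some @: A : {set add_leaf t0}).
Proof.
move=> t0A cA; apply: (@connected_setU1 _ _ (Some t0 : add_leaf t0)).
- exact: connected_Some.
- exact: imset_f.
- by rewrite /edge /=.
Qed.

(** In a cycle through [None], both neighbours of [None] would be [t0], although they are distinct
    in a cycle with more than two vertices. A cycle avoiding [None] comes from [T]. *)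
Lemma tree_add_leaf (T : sgraph) (t0 : T) : tree T -> tree (add_leaf t0).
Proof.
case=> cT acyc; split.
  suff -> : connected (add_leaf t0) =
      connected_set (None |: Some @: [set: T] : {set add_leaf t0}).
    by apply: connected_None cT; rewrite inE.
  congr connected_set; apply/setP=> -[t|]; rewrite !inE //=.
  by rewrite imset_f ?inE.
move=> c sc uc; case: (boolP (None \in c)) => [Nc | nNc].
  have [i c' Ec] := rot_to Nc.
  have {uc} : ucycle edge (None :: c' : seq (add_leaf t0)) by rewrite -Ec rot_ucycle.
  have {sc} : 1 < size c' by move: sc; rewrite -(size_rot i) Ec.
  case: c' {Ec} => [//|y c'] sc.
  rewrite /ucycle /= rcons_path => /andP[/and3P[ey _ el]] /and3P[_ yc _].
  have lt : last y c' = Some t0 by case: (last y c') el => // t /eqP->.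
  have yt : y = Some t0 by case: y ey {yc el sc lt} => // t /eqP->.
  by case: c' sc yc lt {el} => // z c' _ yc lz; move: yc; rewrite yt -lz /= mem_last.
pose d := pmap id c.
have Ed : c = map Some d.
  rewrite /d; elim: c nNc {sc uc d} => //= -[t|] c IHc; rewrite inE //=.
  by move=> nNc; rewrite -IHc.
apply: (acyc d); first by rewrite Ed size_map in sc.
move: uc; rewrite Ed /ucycle (map_inj_uniq Some_inj) => /andP[cd ->].
rewrite andbT; case: (d) cd => //= a l; rewrite -map_rcons.
by move: (rcons l a) => m; elim: m a => //= b m IHm a /andP[-> /IHm].
Qed.

(** A new bag [X] becomes a leaf attached to a node carrying [Y]. A vertex of [X] that occurred
    before lies in [Y], so the set of nodes containing it stays connected. *)
Lemma tree_of_bag_list (G : sgraph) (s : seq {set G}) : bag_list s ->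
  exists (T : sgraph) (B : T -> {set G}), [/\ tree T,
    forall x, x \in cover_seq s -> connected_set [set t | x \in B t]
    & forall X, X \in s <-> exists t, B t = X].
Proof.
elim=> [R | X Y s' _ [T [B [tT cB sB]]] Ys sX].
  have all1 (A : {set complete 1}) : ord0 \in A -> connected_set A.
    move=> A0; have -> : A = [set ord0]; last exact: connected_set1.
    by apply/setP=> t; rewrite ord1 A0 inE eqxx.
  exists (complete 1), (fun=> R); split.
  - split=> [|c lt2c]; first by apply: all1; rewrite inE.
    case/andP=> _ /card_uniqP size_c.
    by have := max_card (mem c); rewrite size_c card_ord leqNgt (ltnW lt2c).
  - by move=> x /cover_seqP[X]; rewrite inE => /eqP-> xR; apply: all1; rewrite inE.
  - by move=> X; rewrite inE; split=> [/eqP->|[_ ->]]; first by exists ord0.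
have [t0 Et0] := (sB Y).1 Ys.
pose B' (t : add_leaf t0) := if t is Some t' then B t' else X.
have covB x : x \in cover_seq s' <-> exists t, x \in B t.
  split=> [/cover_seqP[Z /sB[t <-] xt]|[t xt]]; first by exists t.
  by apply/cover_seqP; exists (B t); rewrite // sB; exists t.
exists (add_leaf t0), B'; split.
- exact: tree_add_leaf.
- move=> x; rewrite cover_seq_cons inE => xc.
  have ES : [set t in add_leaf t0 | x \in B' t] =
      (if x \in X then [set None] else set0) :|: Some @: [set t | x \in B t].
    apply/setP=> -[t|]; rewrite !inE; last first.
      case: ifP => [xX|_]; rewrite inE //=.
      by apply/esym/negbTE/imsetP=> -[].
    case: ifP => _; rewrite inE ?orFb /=; apply/idP/imsetP=> [xt|[t' + [->]]].
    - by exists t; rewrite // inE.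
    - by rewrite inE.
    - by exists t; rewrite // inE.
    - by rewrite inE.
  have -> : [set t | x \in B' t] = [set t in add_leaf t0 | x \in B' t].
    by apply/setP=> t; rewrite !inE.
  rewrite ES; case: (boolP (x \in X)) xc => [xX _|nX /= xs]; last first.
    by rewrite set0U; apply/connected_Some/cB.
  case: (boolP (x \in cover_seq s')) => [xs|nxs].
    apply: connected_None (cB x xs); rewrite inE Et0.
    by apply: (subsetP sX); rewrite inE xX.
  have -> : [set t | x \in B t] = set0.
    apply/setP=> t; rewrite !inE; apply: contraNF nxs => xt.
    by apply/covB; exists t.
  by rewrite imset0 setU0; apply: connected_set1.
- move=> Z; rewrite inE; split=> [/predU1P[->|/sB[t <-]]|[[t|] <-]].
  + by exists None.
  + by exists (Some t).
  + by rewrite orbC (_ : B t \in s') //; apply/sB; exists t.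
  + by rewrite eqxx.
Qed.

(** The disjunct [x == y] makes the bags cover every vertex, including isolated ones. *)
Lemma treewidth_bag_list (G : sgraph) (s : seq {set G}) w :
  bag_list s -> (forall X, X \in s -> #|X| <= w.+1) ->
  (forall x y : G, (x == y) || edge x y -> exists2 X, X \in s & (x \in X) && (y \in X)) ->
  treewidth G <= w.
Proof.
move=> bs small cov; have [T [B [tT cB sB]]] := tree_of_bag_list bs.
have ltw : width B <= w.
  rewrite /width; suff : \max_t #|B t| <= w.+1 by case: (\max_t _).
  by apply/bigmax_leqP=> t _; apply: small; apply/sB; exists t.
apply: leq_trans ltw; rewrite /treewidth; case: ex_minnP => m _; apply.
apply/asboolP; exists T, B; split=> //; split=> // [x|x y exy].
  apply: cB; have [|X Xs /andP[xX _]] := cov x x; first by rewrite eqxx.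
  by apply/cover_seqP; exists X.
have [|X /sB[t <-] xyt] := cov x y; first by rewrite exy orbT.
by exists t.
Qed.

(* Induction on |U| + |U - W|: enlarge W to 2k + 1 vertices, then add the bag
   W + S for a balanced separator S of W and recurse on each component C of
   U - S, with C + S in place of U and (W & C) + S in place of W. *)
Lemma extend_bag_list (G : sgraph) k :
  (forall W : {set G}, exists2 S : {set G}, #|S| <= k &
     forall X, connected_set X -> [disjoint X & S] -> 2 * #|X :&: W| <= #|W|) ->
  forall (U W : {set G}) (s : seq {set G}),
    W \subset U -> #|W| <= (2 * k).+1 -> bag_list s ->
    (forall X, X \in s -> #|X| <= (3 * k).+1) ->
    (exists2 X, X \in s & W \subset X) -> U :&: cover_seq s \subset W ->
  exists s', [/\ bag_list s', forall X, X \in s' -> #|X| <= (3 * k).+1,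
    {subset s <= s'}, cover_seq s' \subset cover_seq s :|: U
    & forall x y, x \in U -> y \in U -> (x == y) || edge x y ->
        exists2 X, X \in s' & (x \in X) && (y \in X)].
Proof.
move=> sepG U W; have [m] := ubnP (#|U| + #|U :\: W|).
elim: m U W => // m IHm U W ltm s sWU cW bs small [X0 X0s sWX] run.
have [leW | gtW] := leqP #|W| (2 * k).
  case: (boolP (U \subset W)) => [sUW | /subsetPn[u uU uW]].
    exists s; split=> //; first exact: subsetUl.
    move=> x y xU yU _; exists X0 => //.
    by rewrite !(subsetP sWX) // (subsetP sUW).
  have sW'U : u |: W \subset U by rewrite subUset sub1set uU.
  have [||||||s' [bs' small' ss' cs' cov']] := IHm U (u |: W) _ ((u |: W) :: s) sW'U.
  - rewrite ltnS in ltm; apply: leq_trans ltm; rewrite ltn_add2l.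
    apply: proper_card; apply/properP; split.
      by apply: setDS; apply: subsetUr.
    by exists u; rewrite !inE ?eqxx // uW uU.
  - by rewrite cardsU1 uW ltnS.
  - apply: bag_listS bs X0s _; apply: subset_trans sWX.
    by apply: subset_trans run; rewrite setSI.
  - move=> X; rewrite inE => /predU1P[->|/small//].
    by rewrite cardsU1 uW; lia.
  - by exists (u |: W); rewrite ?mem_head.
  - rewrite cover_seq_cons setIUr subUset subsetIr /=.
    by apply: subset_trans run _; apply: subsetUr.
  exists s'; split=> //.
  - by move=> X Xs; apply: ss'; rewrite inE Xs orbT.
  - apply: subset_trans cs' _; rewrite cover_seq_cons subUset subsetUr andbT subUset subsetUl andbT.
    by apply: subset_trans sW'U _; apply: subsetUr.
(* The size is odd, so a connected set avoiding [S] contains at most [k] vertices of [W]. *)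
have {gtW} {}cW : #|W| = (2 * k).+1 by apply/eqP; rewrite eqn_leq cW gtW.
have [S cS sepS] := sepG W.
pose S' := S :&: U; pose D := U :\: S'.
have cS' : #|S'| <= k by apply: leq_trans cS; apply/subset_leq_card/subsetIl.
have S'U z : z \in S' -> z \in U by rewrite inE => /andP[].
have compU x : x \in D -> component D x \subset U.
  by move=> xD; apply: subset_trans (component_sub xD) (subsetDl _ _).
have compS x z : x \in D -> z \in component D x -> z \notin S'.
  by move=> xD /(subsetP (component_sub xD)); rewrite !inE => /andP[].
have compW x : x \in D -> #|component D x :&: W| <= k.
  move=> xD; suff : 2 * #|component D x :&: W| <= #|W| by lia.
  apply: sepS; first exact: connected_component.
  rewrite disjoint_subset; apply/subsetP=> z zx; rewrite !inE.
  have := compS x z xD zx; rewrite inE negb_and => /orP[//|].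
  by rewrite (subsetP (compU x xD)).
pose b := W :|: S'.
have bs1 : bag_list (b :: s).
  apply: bag_listS bs X0s _; apply/subsetP=> z; rewrite !inE => /andP[zb zs].
  apply/(subsetP sWX)/(subsetP run); rewrite inE zs andbT.
  by case/orP: zb => [/(subsetP sWU)|/andP[]].
(* The components of [D] are treated one at a time, [l] listing representatives. The fourth clause
   confines new vertices to components already treated, which keeps the running intersection
   property. *)
have inner : forall l : seq G, {subset l <= D} -> exists s', [/\ bag_list s',
    forall X, X \in s' -> #|X| <= (3 * k).+1, {subset b :: s <= s'},
    forall z, z \in cover_seq s' -> z \in cover_seq (b :: s) \/
       exists2 x, x \in l & z \in component D x
    & forall x, x \in l -> forall u v, u \in component D x :|: S' ->
        v \in component D x :|: S' -> (u == v) || edge u v ->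
        exists2 X, X \in s' & (u \in X) && (v \in X)].
  elim=> [|x l IHl] slD.
    exists (b :: s); split=> // [X|z zs]; last by left.
    rewrite inE => /predU1P[->|/small//].
    by rewrite /b cardsU; lia.
  have xD : x \in D by apply: slD; rewrite mem_head.
  have [|s2 [bs2 small2 ss2 cs2 cov2]] := IHl.
    by move=> y yl; apply: slD; rewrite inE yl orbT.
  have cs2' z : z \in cover_seq s2 -> z \in cover_seq (b :: s) \/
      exists2 y, y \in x :: l & z \in component D y.
    case/cs2=> [zs|[y yl zy]]; [by left | right; exists y => //].
    by rewrite inE yl orbT.
  have [[y yl Exy] | nold] := pselect (exists2 y, y \in l & component D x = component D y).
    exists s2; split=> // x'; rewrite inE => /predU1P[->|/cov2//].
    by rewrite Exy; apply: cov2.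
  pose C := component D x; pose U' := C :|: S'; pose W' := (C :&: W) :|: S'.
  have sU'U : U' \subset U.
    by rewrite subUset compU //; apply/subsetP=> z /S'U.
  have cW' : #|W'| <= 2 * k.
    by have := compW x xD; rewrite /W' cardsU -/C; lia.
  have [|||||||s3 [bs3 small3 ss3 cs3 cov3]] := IHm U' W' _ s2.
  (* The measure drops: if [U'] were all of [U], then [W'] would contain the [2k + 1] vertices of
     [W], but it has at most [2k]. Moreover [U' :\: W'] lies in [U :\: W]. *)
  - rewrite ltnS in ltm; apply: leq_trans ltm; rewrite -addSn leq_add //.
      apply: proper_card; rewrite properE sU'U /=; apply: contraL cW' => sUU'.
      rewrite -ltnNge -[_.+1]cW; apply: subset_leq_card; apply/subsetP=> z zW.
      by move: (subsetP sUU' z (subsetP sWU z zW)); rewrite /U' /W' !inE zW andbT.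
    apply: subset_leq_card; apply/subsetP=> z; rewrite /U' /W' [in X in X -> _]inE in_setU.
    rewrite [z \in _ :\: W]inE in_setU in_setI negb_or negb_and.
    case/andP=> /andP[nCW nS'] /orP[zC|zS']; last by rewrite zS' in nS'.
    by rewrite zC /= in nCW; rewrite nCW (subsetP (compU x xD)).
  - by apply: setSU; apply: subsetIl.
  - by apply: leq_trans cW' _.
  - exact: bs2.
  - exact: small2.
  - exists b; first by apply: ss2; rewrite mem_head.
    by apply: setSU; apply: subsetIr.
  (* Distinct components are disjoint, so a vertex of [C] covered so far lies in a bag of [b :: s],
     hence in [W]. *)
  - apply/subsetP=> z; rewrite in_setI => /andP[zU' zs2].
    move: (zU'); rewrite /U' /W' !in_setU in_setI => /orP[zC|->]; last by rewrite orbT.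
    rewrite zC /=; case: (cs2 z zs2) => [|[y yl zy]]; last first.
      by case: nold; exists y => //; apply: component_eq zC zy.
    rewrite cover_seq_cons !in_setU => /orP[//|zs].
    by rewrite (subsetP run) // in_setI zs (subsetP sU'U).
  exists s3; split=> //.
  - by move=> X /ss2/ss3.
  - move=> z /(subsetP cs3); rewrite in_setU => /orP[/cs2'//|].
    rewrite in_setU => /orP[zC|zS]; first by right; exists x; rewrite ?mem_head.
    by left; rewrite cover_seq_cons !in_setU zS orbT.
  - move=> y; rewrite inE => /predU1P[->|yl] u v uy vy uv; first exact: cov3.
    have [X /ss3 Xs uvX] := cov2 y yl u v uy vy uv; by exists X.
have [|s' [bs' small' ss' cs' cov']] := inner (enum D).
  by move=> x; rewrite mem_enum.
exists s'; split=> //.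
- by move=> X Xs; apply: ss'; rewrite inE Xs orbT.
- apply/subsetP=> z /cs'; rewrite cover_seq_cons !in_setU.
  case=> [/orP[/orP[/(subsetP sWU)|/S'U]|]|[x]] => [->|->|->|]; rewrite ?orbT //.
  by rewrite mem_enum => xD /(subsetP (compU x xD)) ->; rewrite orbT.
(* An edge with an end [x] outside [S'] stays within the component of [x] and [S']; an edge inside
   [S'] is covered by [b]. *)
- have inD z : z \in U -> z \notin S' -> z \in D by move=> zU zS; rewrite inE zU zS.
  have main x y : x \in U -> y \in U -> x \notin S' -> (x == y) || edge x y ->
      exists2 X, X \in s' & (x \in X) && (y \in X).
    move=> xU yU xS xy; have xD := inD x xU xS.
    apply: (cov' x) (xy); rewrite ?mem_enum // in_setU; first by rewrite mem_component.
    case: (boolP (y \in S')) => [_|yS]; rewrite ?orbT // orbF.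
    case/predU1P: (xy) => [<-|exy]; first exact: mem_component.
    by apply: component_edge exy; rewrite ?mem_component // inD.
  move=> x y xU yU xy; case: (boolP (x \in S')) => [xS|xS]; last exact: main.
  case: (boolP (y \in S')) => [yS|yS]; last first.
    have [|X Xs] := main y x yU xU yS; first by rewrite eq_sym edge_sym.
    by rewrite andbC; exists X.
  by exists b; rewrite ?ss' ?mem_head // !in_setU xS yS !orbT.
Qed.

Lemma treewidth_separators (G : sgraph) k :
  (forall W : {set G}, exists2 S : {set G}, #|S| <= k &
     forall X, connected_set X -> [disjoint X & S] -> 2 * #|X :&: W| <= #|W|) ->
  treewidth G <= 3 * k.
Proof.
move=> sepG.
have [||||||s [bs small _ _ cov]] :=
  @extend_bag_list G k sepG [set: G] set0 [:: set0].
- exact: sub0set.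
- by rewrite cards0.
- exact: bag_list1.
- by move=> X; rewrite inE => /eqP->; rewrite cards0.
- by exists set0; rewrite ?mem_head.
- by rewrite /cover_seq big_seq1 setI0 sub0set.
by apply: treewidth_bag_list bs small _ => x y; apply: cov; rewrite inE.
Qed.

(** * Brambles and linked segments of a path *)

(* A bramble whose members pairwise intersect, rather than merely touch. *)
Definition bramble (G : sgraph) (B : {set G} -> Prop) :=
  (forall X, B X -> connected_set X) /\
  forall X Y, B X -> B Y -> exists2 z, z \in X & z \in Y.

Lemma bramble_of_treewidth (G : sgraph) k : 3 * k < treewidth G ->
  exists2 B : {set G} -> Prop, bramble B &
    forall S : {set G}, #|S| <= k -> exists2 X, B X & [disjoint X & S].
Proof.
move=> lttw; have [W nW] : exists W : {set G}, forall S : {set G}, #|S| <= k ->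
    exists2 X, connected_set X & [disjoint X & S] /\ #|W| < 2 * #|X :&: W|.
  apply: contrapT => nW; move: lttw; rewrite ltnNge => /negP; apply.
  apply: treewidth_separators => W; apply: contrapT => nS; apply: nW.
  exists W => S cS; apply: contrapT => nX; apply: nS; exists S => // X cX dX.
  by rewrite leqNgt; apply/negP=> gtX; apply: nX; exists X.
exists (fun X => connected_set X /\ #|W| < 2 * #|X :&: W|).
  (* Two sets each containing more than half of [W] share a vertex of [W]. *)
  split=> [X [//]|X Y [_ gX] [_ gY]]; apply: contrapT => nz.
  have := subset_leq_card (_ : (X :&: W) :|: (Y :&: W) \subset W).
  rewrite -setIUl subsetIr => /(_ isT); rewrite setIUl cardsU.
  suff -> : X :&: W :&: (Y :&: W) = set0 by rewrite cards0; lia.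
  apply/setP=> z; rewrite !inE; apply/negP=> /andP[/andP[zX _] /andP[zY _]].
  by apply: nz; exists z.
by move=> S /nW[X cX [dX gX]]; exists X.
Qed.

Definition meets (G : sgraph) (X : {set G}) (l : seq G) := exists2 z, z \in X & z \in l.

(** Paths grow at their head: the vertices of [q] are put in front one by one until [Y] is first
    reached, so the new head is the only vertex in [Y]. *)
Lemma extend_path_to (G : sgraph) (Y : {set G}) q x p :
  path edge x p -> uniq (x :: p) -> path edge x q -> uniq (x :: q) ->
  (forall z, z \in q -> z \notin p) -> (forall z, z \in x :: p -> z \notin Y) ->
  last x q \in Y ->
  exists y l, [/\ path edge y l, uniq (y :: l), y \in Y,
    forall z, z \in l -> z \notin Y & size p < size l].
Proof.
elim: q x p => [|z q IHq] x p xp up.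
  by move=> _ _ _ nY xY; have := nY x (mem_head _ _); rewrite xY.
rewrite [path _ _ _]/= => /andP[exz zq] /andP[xnq uq] dq nY lY.
have up' : uniq [:: z, x & p].
  rewrite cons_uniq up andbT inE negb_or dq ?mem_head // andbT.
  by apply: contraNneq xnq => ->; apply: mem_head.
have xp' : path edge z (x :: p) by rewrite /= edge_sym exz.
case: (boolP (z \in Y)) => [zY|znY].
  by exists z, (x :: p); split.
have [||y [l [yl ul yY lnY ltl]]] := IHq z (x :: p) xp' up' zq uq _ _ lY.
- move=> t tq; rewrite inE negb_or dq ?inE ?tq ?orbT // andbT.
  by apply: contraNneq xnq => <-; rewrite inE tq orbT.
- by move=> t; rewrite inE => /predU1P[->//|/nY].
by exists y, l; split=> //; apply: leq_trans ltl; rewrite /= ltnS.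
Qed.

(** Maintain a path whose head is its only vertex in some member [X]. If it misses a member [Y],
    walk inside the connected set [X] from the head towards a common vertex of [X] and [Y], stopping
    on reaching [Y]. The rest of the path avoids [X], so the result is again a path; it is longer,
    so the process ends. *)
Lemma bramble_path (G : sgraph) (B : {set G} -> Prop) : bramble B ->
  exists l, [/\ sorted edge l, uniq l & forall X, B X -> meets X l].
Proof.
case=> cB mB; have [[X0 BX0]|noB] := pselect (exists X, B X); last first.
  by exists [::]; split=> // X BX; case: noB; exists X.
have [x0 x0X] := connected_set_neq0 (cB _ BX0).
suff main m x p X : #|G| - size p <= m -> path edge x p -> uniq (x :: p) -> B X ->
    x \in X -> (forall z, z \in p -> z \notin X) ->
    exists l, [/\ sorted edge l, uniq l & forall X, B X -> meets X l].
  by apply: (main _ x0 [::] X0 (leqnn _)).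
elim: m x p X => [|m IHm] x p X lem xp up BX xX pX.
  have := max_card (mem (x :: p)); rewrite (card_uniqP up) => lep.
  by rewrite leqn0 subn_eq0 leqNgt lep in lem.
have [hit|/existsNP[Y /not_implyP[BY nY]]] :=
    pselect (forall Y, B Y -> meets Y (x :: p)); first by exists (x :: p).
have [w wX wY] := mB X Y BX BY.
case/connectP: (connected_set_connect (cB X BX) xX wX) => q0 q0p.
case/shortenP: q0p => q /path_edge_in[xq qX] uq _ Ew.
have [|||y [l [yl ul yY lY ltl]]] := @extend_path_to G Y q x p xp up xq uq.
- by move=> z /qX zX; apply: contraL zX; apply: pX.
- by move=> z zp; apply/negP=> zY; apply: nY; exists z.
- by rewrite -Ew.
apply: (IHm y l Y) => //.
have := max_card (mem (x :: p)); rewrite (card_uniqP up) [size _]/= => lep; lia.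
Qed.

(** In bramble terms: the members of [B] that meet [l] form a bramble of order at least [k]. *)
Definition heavy (G : sgraph) (B : {set G} -> Prop) k (l : seq G) :=
  forall S : {set G}, #|S| < k -> exists X, [/\ B X, meets X l & [disjoint X & S]].

(** Cut off the shortest prefix that is heavy for [k]. Fewer than [k] vertices hit all members
    meeting the prefix without its last vertex; adding that vertex gives at most [k] vertices
    hitting all members meeting the prefix. Hence the rest of the path loses at most [k] and the
    induction continues. *)
Lemma heavy_segments (G : sgraph) (B : {set G} -> Prop) k n (l : seq G) :
  0 < k -> sorted edge l -> uniq l -> heavy B (n * k) l ->
  exists A : nat -> seq G, [/\ forall i, i < n -> sorted edge (A i) /\ heavy B k (A i),
    forall i, i < n -> {subset A i <= l}
    & forall i j z, i < n -> j < n -> z \in A i -> z \in A j -> i = j].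
Proof.
move=> k0; elim: n l => [|n IHn] l sl ul hl.
  by exists (fun=> [::]); split.
have exh : exists i, `[< heavy B k (take i l) >].
  exists (size l); apply/asboolP; rewrite take_size => S ltS; apply: hl.
  by apply: leq_trans ltS _; rewrite leq_pmull.
(* The empty prefix meets no member, so it is not heavy, because [k] is positive. *)
case: (ex_minnP exh) => -[|i] /asboolP hi mini.
  have [|X [_ [z]]] := hi set0; first by rewrite cards0.
  by rewrite take0.
have [S0 ltS0 S0P] : exists2 S0 : {set G}, #|S0| < k & forall X, B X ->
    meets X (take i l) -> ~ [disjoint X & S0].
  have : ~ heavy B k (take i l) by move/asboolP/mini; rewrite ltnn.
  case/existsNP=> S0 /not_implyP[ltS0 nX]; exists S0 => // X BX mX dX.
  by apply: nX; exists X.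
have [S1 cS1 S1P] : exists2 S1 : {set G}, #|S1| <= k & forall X, B X ->
    meets X (take i.+1 l) -> ~ [disjoint X & S1].
  have [lei|lti] := leqP (size l) i.
    by exists S0; [apply: ltnW | move: S0P; rewrite !take_oversize // leqW].
  case: l lti {sl ul hl exh hi mini IHn} S0P => // v0 l lti S0P.
  exists (nth v0 (v0 :: l) i |: S0); first by rewrite cardsU1; lia.
  move=> X BX [z zX]; rewrite (take_nth v0) // mem_rcons inE.
  case/predU1P=> [Ez|zl] dX; first by have := disjointFr dX zX; rewrite Ez setU11.
  apply: (S0P X BX); first by exists z.
  by apply: disjointWr dX; apply: subsetUr.
have Hl := cat_take_drop i.+1 l.
have [||| A [hA sA dA]] := IHn (drop i.+1 l).
- exact: drop_sorted.
- exact: drop_uniq.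
- move=> S ltS; have [|X [BX [z zX zl] dX]] := hl (S :|: S1).
    by rewrite mulSn addnC cardsU; lia.
  have [dXS dXS1] : [disjoint X & S] /\ [disjoint X & S1].
    by split; apply: disjointWr dX; [apply: subsetUl | apply: subsetUr].
  exists X; split=> //; exists z => //; move: zl; rewrite -{1}Hl mem_cat.
  by case/orP=> // zl; case: (S1P X BX) => //; exists z.
have dl z : z \in take i.+1 l -> z \in drop i.+1 l -> False.
  move: ul; rewrite -{1}Hl cat_uniq => /and3P[_ /hasPn nl _] zt zd.
  by have := nl z zd; rewrite /= zt.
exists (fun j => if j is j'.+1 then A j' else take i.+1 l); split.
- by case=> [_|j]; [split=> //; apply: take_sorted | apply: hA].
- case=> [_|j ltj] z; first exact: mem_take.
  by move/(sA j ltj); apply: mem_drop.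
- case=> [|j] [|j'] z // ltj ltj' zj zj'.
  + by case: (dl z) => //; apply: (sA j').
  + by case: (dl z) => //; apply: (sA j).
  + by congr _.+1; apply: (dA j j' z).
Qed.

(** Given fewer than [k] vertices, some member meeting [l] and some member meeting [l'] avoid them.
    These members intersect, so their union contains a path from [l] to [l'] that avoids the given
    vertices, and Menger's theorem applies. *)
Lemma heavy_linked (G : sgraph) (B : {set G} -> Prop) k (l l' : seq G) :
  bramble B -> heavy B k l -> heavy B k l' ->
  exists P : 'I_k -> {set G}, [/\ forall i, connected_set (P i),
    forall i, exists2 z, z \in P i & z \in l, forall i, exists2 z, z \in P i & z \in l'
    & forall i j z, z \in P i -> z \in P j -> i = j].
Proof.
case=> cB mB hl hl'.
have [|a [p [lp _ dp]]] := @menger G edge [set z in l] [set z in l'] k.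
  move=> S sepS; rewrite leqNgt; apply/negP=> ltS.
  have [X [BX [x xX xl] dX]] := hl S ltS; have [Y [BY [y yY yl] dY]] := hl' S ltS.
  have [z zX zY] := mB X Y BX BY.
  case/connectP: (connected_set_connect (cB X BX) xX zX) => p /path_edge_in[xp sp] Ez.
  case/connectP: (connected_set_connect (cB Y BY) zY yY) => q /path_edge_in[zq sq] Ey.
  have := sepS x (p ++ q); rewrite /linking !inE xl cat_path xp -Ez zq last_cat -Ez -Ey yl.
  move=> /(_ isT)/hasP[w wpq /= Sw].
  have [wX|wY] : w \in X \/ w \in Y.
    move: wpq; rewrite -cat_cons mem_cat inE => /orP[/predU1P[->|/sp]|/sq]; by [left | right].
  - by rewrite (disjointFr dX wX) in Sw.
  - by rewrite (disjointFr dY wY) in Sw.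
exists (fun i => [set z in a i :: p i]); split.
- by move=> i; case/and3P: (lp i) => _ ap _; apply: connected_set_path.
- move=> i; case/and3P: (lp i); rewrite inE => al _ _.
  by exists (a i); rewrite // inE mem_head.
- move=> i; case/and3P: (lp i) => _ _; rewrite inE => ll.
  by exists (last (a i) (p i)); rewrite // inE mem_last.
- by move=> i j z; rewrite ![_ \in [set _ in _]]inE; apply: dp.
Qed.

(** * Clique minors in Cartesian products *)

(** A union bound over the elements of [s]. *)
Lemma card_has_le (U V : finType) (A : {set U}) (R : V -> pred U) (s : seq V) b :
  (forall v, v \in s -> #|[set x in A | R v x]| <= b) ->
  #|[set x in A | has (R^~ x) s]| <= b * size s.
Proof.
elim: s => [|v s IHs] le_b.
  by rewrite muln0 leqn0 cards_eq0; apply/eqP/setP=> x; rewrite !inE andbF.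
have -> : [set x in A | has (R^~ x) (v :: s)] =
    [set x in A | R v x] :|: [set x in A | has (R^~ x) s].
  by apply/setP=> x; rewrite !inE /= andb_orr.
apply: leq_trans (leq_card_setU _ _) _; rewrite /= mulnS leq_add ?le_b ?mem_head //.
by apply: IHs => w ws; apply: le_b; rewrite inE ws orbT.
Qed.

(* Either some member of the first family leaves enough disjoint members in all
   others, or n of its members hit almost all of one other family. *)
Lemma disjoint_choice (T : finType) (I : finType) n (es : seq I) (F : I -> {set {set T}}) :
  0 < n -> uniq es -> (forall e, e \in es -> (2 * n) ^ size es <= #|F e|) ->
  (exists e f (X Y : seq {set T}), [/\ [/\ e \in es, f \in es & e != f],
     [/\ uniq X, size X = n & {subset X <= F e}],
     [/\ uniq Y, size Y = n & {subset Y <= F f}]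
     & forall x y, x \in X -> y \in Y -> ~~ [disjoint x & y]]) \/
  exists q : I -> {set T}, (forall e, e \in es -> q e \in F e) /\
    forall e f, e \in es -> f \in es -> e != f -> [disjoint q e & q f].
Proof.
move=> n0; elim: es F => [|e es IHes] F; first by right; exists (fun=> set0).
rewrite cons_uniq => /andP[ne ues] bigF.
set b := (2 * n) ^ size es in bigF *.
have bigF' f : f \in e :: es -> 2 * n * b <= #|F f|.
  by move/bigF; rewrite [size _]/= expnS.
have b0 : 0 < b by rewrite expn_gt0 muln_gt0 n0.
pose F' (x : {set T}) f := [set y in F f | [disjoint x & y]].
have F'F x f : F' x f \subset F f by apply/subsetP=> y; rewrite inE => /andP[].
have [[x Fx good] | nogood] :=
    pselect (exists2 x, x \in F e & forall f, f \in es -> b <= #|F' x f|).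
  case: (IHes (F' x) ues good) => [[e' [f [X [Y H]]]] | [q [qF qd]]].
    case: H => [[ee fe ef] [uX sX XF] [uY sY YF] XY].
    left; exists e', f, X, Y; split=> //; split=> //.
    - by rewrite inE ee orbT.
    - by rewrite inE fe orbT.
    - by move=> z /XF; apply: (subsetP (F'F x e')).
    - by move=> z /YF; apply: (subsetP (F'F x f)).
  right; exists (fun f => if f == e then x else q f); split.
    move=> f; rewrite inE; case: eqVneq => [->//|_ /= fe].
    exact: (subsetP (F'F x f)) (qF f fe).
  have xq f : f \in es -> [disjoint x & q f] by move/qF; rewrite inE => /andP[].
  move=> f g; rewrite !inE; case: eqVneq => [->|_]; case: eqVneq => [->|_] //=.
  - by move=> _ /xq.
  - by move=> /xq; rewrite disjoint_sym.
  - exact: qd.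
left; pose bad f x := #|F' x f| < b.
(* Otherwise each [x] in [F e] is bad for some [f] in [es]. If each [f] had at most [n - 1] bad
   sets, [F e] would have at most [(n - 1) * size es] members, fewer than [2 * n * b]. *)
have [f fes badf] : exists2 f, f \in es & n <= #|[set x in F e | bad f x]|.
  apply: contrapT => nf; have : #|[set x in F e | has (bad^~ x) es]| <= n.-1 * size es.
    apply: card_has_le => f fes; rewrite -ltnS prednK // ltnNge.
    by apply/negP=> le; apply: nf; exists f.
  have -> : [set x in F e | has (bad^~ x) es] = F e.
    apply/setP=> x; rewrite inE; case: (boolP (x \in F e)) => //= Fx.
    apply/negPn/negP=> nh; apply: nogood; exists x => // f fes.
    by move/hasPn: nh => /(_ f fes); rewrite /= /bad -leqNgt.
  have := bigF' e (mem_head _ _); have : size es < b.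
    apply: leq_trans (ltn_expl _ (isT : 1 < 2)) _.
    by rewrite /b; case: (size es) => // s; rewrite leq_exp2r //; lia.
  nia.
have [X [uX sX XB]] := card_geqP badf.
(* Each of the [n] sets in [X] is disjoint from fewer than [b] members of [F f], so at least
   [2nb - nb] members meet all of them. *)
have : n <= #|F f :\: [set y in F f | has (fun x : {set T} => [disjoint x & y]) X]|.
  have fe : f \in e :: es by rewrite inE fes orbT.
  have bF := bigF' f fe.
  rewrite cardsD (setIidPr _); last by apply/subsetP=> y; rewrite inE => /andP[].
  have le : #|[set y in F f | has (fun x : {set T} => [disjoint x & y]) X]| <= b * n.
    rewrite -sX; apply: (@card_has_le _ _ (F f) (fun x y : {set T} => [disjoint x & y])).
    by move=> x /XB; rewrite inE => /andP[_]; apply: ltnW.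
  nia.
case/card_geqP=> Y [uY sY YB]; exists e, f, X, Y; split=> //.
- by split; rewrite ?mem_head ?inE ?fes ?orbT //; apply: contraNneq ne => ->.
- by split=> // x /XB; rewrite inE => /andP[].
- by split=> // y /YB; rewrite !inE => /andP[].
- move=> x y xX /YB; rewrite !inE => /andP[+ Fy]; rewrite Fy /=.
  by move/hasPn/(_ x xX).
Qed.

(** The branch set of [i] is [A i] in the layer of [h0] together with [R i] in the layer of [h1].
    The set [R i] may be disconnected: each piece [C] contains a vertex [z] of [A i], and the edge
    above [z] joins the layers. A common vertex of [R i] and [A j] likewise makes branch sets
    adjacent. *)
Lemma cart_prod_minor (G H : sgraph) n (A R : 'I_n -> {set G}) (h0 h1 : H) :
  edge h0 h1 -> (forall i, connected_set (A i)) ->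
  (forall i v, v \in R i -> exists C, [/\ connected_set C, v \in C, C \subset R i &
     exists2 z, z \in C & z \in A i]) ->
  (forall i j z, z \in A i -> z \in A j -> i = j) ->
  (forall i j z, z \in R i -> z \in R j -> i = j) ->
  (forall i j, i != j -> exists2 z, z \in R i & z \in A j) ->
  minor (complete n) (cart_prod G H).
Proof.
move=> e01 cA cR dA dR meet.
have neh : h0 == h1 = false by apply: contraTF e01 => /eqP->; rewrite edge_irrefl.
pose lay h (x : G) : cart_prod G H := (x, h).
have layC h C : connected_set C -> connected_set (lay h @: C).
  by apply: connected_set_imset => x y exy; rewrite /edge /= /cart_edge /= exy eqxx.
pose M : {ffun complete n -> {set cart_prod G H}} :=
  [ffun i => lay h0 @: A i :|: lay h1 @: R i].
have memM (i : 'I_n) x h : ((x, h) \in M i) = (h == h0) && (x \in A i) || (h == h1) && (x \in R i).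
  rewrite /M ffunE in_setU; congr orb.
    apply/imsetP/andP=> [[y yA [-> ->]]|[/eqP-> xA]]; [by rewrite eqxx | by exists x].
  apply/imsetP/andP=> [[y yA [-> ->]]|[/eqP-> xA]]; [by rewrite eqxx | by exists x].
apply/existsP; exists M; apply/and3P; split.
- apply/forallP=> i; have [a aA] := connected_set_neq0 (cA i).
  have sAM : lay h0 @: A i \subset M i by rewrite /M ffunE subsetUl.
  apply: (@connected_setP _ _ (lay h0 a)).
    by apply: (subsetP sAM); apply: imset_f.
  case=> x h; rewrite memM => /orP[/andP[/eqP-> xA]|/andP[/eqP-> xR]].
    by apply: (connected_sub_edge_in sAM (layC h0 _ (cA i))); apply: imset_f.
  have [C [cC xC sCR [z zC zA]]] := cR i x xR.
  pose S := (lay h1 z |: lay h0 @: A i) :|: lay h1 @: C.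
  have cS : connected_set S.
    apply: (@connected_setU _ _ _ (lay h1 z)); rewrite ?setU11 ?imset_f ?layC //.
    apply: (@connected_setU1 _ _ (lay h0 z)); rewrite ?imset_f ?layC //.
    by rewrite /edge /= /cart_edge /= eqxx e01 orbT.
  have sCM : lay h1 @: C \subset M i.
    by rewrite /M ffunE; apply: subset_trans (imsetS _ sCR) (subsetUr _ _).
  have sSM : S \subset M i.
    by rewrite !subUset sAM sCM sub1set (subsetP sCM) ?imset_f.
  apply: (connected_sub_edge_in sSM cS); rewrite /S !in_setU ?imset_f ?orbT //.
- apply/forallP=> i; apply/forallP=> j; apply/implyP=> nij.
  rewrite disjoint_subset; apply/subsetP=> -[x h]; rewrite memM inE memM => xi.
  apply: contraNN nij => xj; apply/eqP; move: xi xj.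
  case/orP=> /andP[/eqP-> xi]; rewrite eqxx ?neh ?(eq_sym h1) ?neh /= ?orbF => xj.
    exact: (dA _ _ x).
  exact: (dR _ _ x).
- apply/forallP=> i; apply/forallP=> j; apply/implyP=> nij.
  have [z zR zA] := meet i j nij.
  apply/existsP; exists (lay h1 z); rewrite memM eqxx zR orbT /=.
  apply/existsP; exists (lay h0 z); rewrite memM eqxx zA /=.
  by rewrite /edge /= /cart_edge /= eqxx edge_sym e01 orbT.
Qed.

Lemma minor_of_treewidth (G H : sgraph) n (h0 h1 : H) :
  0 < n -> edge h0 h1 -> 3 * (n * (2 * n) ^ (n * n)) < treewidth G ->
  minor (complete n) (cart_prod G H).
Proof.
move=> n0 e01 /bramble_of_treewidth [B bB ordB].
set k := _ ^ _ in ordB.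
have k0 : 0 < k by rewrite expn_gt0 muln_gt0 n0.
have [l [sl ul hitl]] := bramble_path bB.
have [|A [hA _ dA]] := heavy_segments k0 sl ul (_ : heavy B (n * k) l).
  by move=> S /ltnW/ordB[X BX dX]; exists X; split=> //; apply: hitl.
(* Diagonal pairs [(i, i)] are linked as well, so there are [n * n] families, the exponent in
   [k]. *)
have /choice[P linkP] : forall e : 'I_n * 'I_n, exists P : 'I_k -> {set G},
    [/\ forall i, connected_set (P i),
    forall i, exists2 z, z \in P i & z \in A e.1,
    forall i, exists2 z, z \in P i & z \in A e.2
    & forall i j z, z \in P i -> z \in P j -> i = j].
  by move=> [i j]; apply: (heavy_linked bB); apply: (hA _ _).2.
pose F e := [set P e i | i : 'I_k].
have disF e X Y z : X \in F e -> Y \in F e -> z \in X -> z \in Y -> X = Y.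
  case/imsetP=> i _ -> /imsetP[j _ ->] zi zj.
  by case: (linkP e) => _ _ _ dP; rewrite (dP i j z).
have conF e X : X \in F e -> connected_set X.
  by case/imsetP=> i _ ->; case: (linkP e).
have cF e : #|F e| = k.
  rewrite card_imset ?card_ord // => i j Eij; case: (linkP e) => cP _ _ dP.
  by have [z zi] := connected_set_neq0 (cP i); apply: (dP i j z) => //; rewrite -Eij.
have [||] := @disjoint_choice G _ n (enum {: 'I_n * 'I_n}) F n0 (enum_uniq _).
- by move=> e _; rewrite cF -cardE card_prod !card_ord.
- case=> e [f [X [Y [[_ _ _] [uX sX XF] [uY sY YF] XY]]]].
  have XI (i : 'I_n) : nth set0 X i \in X by rewrite mem_nth ?sX.
  have YI (i : 'I_n) : nth set0 Y i \in Y by rewrite mem_nth ?sY.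
  have XYz (i j : 'I_n) : exists2 z, z \in nth set0 Y i & z \in nth set0 X j.
    have := XY _ _ (XI j) (YI i); rewrite -setI_eq0 => /set0Pn[z].
    by rewrite inE => /andP[zX zY]; exists z.
  (* Two mutually crossing families behave like the rows and columns of a grid, one family in each
     layer. *)
  apply: (@cart_prod_minor G H n (fun i => nth set0 X i) (fun i => nth set0 Y i) h0 h1 e01).
  + by move=> i; apply: conF (XF _ (XI i)).
  + by move=> i v vY; exists (nth set0 Y i); split=> //; apply: conF (YF _ (YI i)).
  + move=> i j z zi zj; apply/val_inj/eqP.
    rewrite -(nth_uniq set0 _ _ uX) ?sX ?ltn_ord //; apply/eqP.
    exact: disF (XF _ (XI i)) (XF _ (XI j)) zi zj.
  + move=> i j z zi zj; apply/val_inj/eqP.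
    rewrite -(nth_uniq set0 _ _ uY) ?sY ?ltn_ord //; apply/eqP.
    exact: disF (YF _ (YI i)) (YF _ (YI j)) zi zj.
  + by move=> i j _; apply: XYz.
case=> q [qF dq].
have qFe e : q e \in F e by apply: qF; rewrite mem_enum.
have dq' e f z : z \in q e -> z \in q f -> e = f.
  move=> ze zf; apply/eqP; apply: contraTT zf => nef.
  by rewrite (disjointFr (dq e f _ _ nef) ze) // mem_enum.
(* One layer holds the segments. In the other, the sets [q (i, j)] with [i] fixed all touch segment
   [i], and [q (i, j)] reaches segment [j]. *)
apply: (@cart_prod_minor G H n (fun i => [set z in A i])
  (fun i => \bigcup_(j : 'I_n) q (i, j)) h0 h1 e01).
- move=> i; have [sA _] := hA i (ltn_ord i); have [_ /(_ set0)] := hA i (ltn_ord i).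
  rewrite cards0 => /(_ k0)[X [_ [z _ zA] _]].
  by case: (A i) sA zA => // a p; rewrite /= => /connected_set_path.
- move=> i v /bigcupP[j _ vq]; exists (q (i, j)); split=> //.
  + exact: conF (qFe _).
  + exact: bigcup_sup.
  + case/imsetP: (qFe (i, j)) => t _ ->; case: (linkP (i, j)) => _ /(_ t)[z zP zA] _ _.
    by exists z; rewrite ?inE.
- by move=> i j z; rewrite !inE => zi zj; apply/val_inj/(dA i j z).
- by move=> i j z /bigcupP[a _ za] /bigcupP[b _ zb]; case: (dq' _ _ _ za zb).
- move=> i j _; case/imsetP: (qFe (i, j)) => t _ Eq.
  case: (linkP (i, j)) => _ _ /(_ t)[z zP zA] _; exists z; last by rewrite inE.
  by apply/bigcupP; exists j => //; rewrite Eq.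
Qed.

(** * Colouring the product and the numerical bound *)

Lemma colorableP (G : sgraph) k :
  reflect (exists f : G -> 'I_k, forall x y, edge x y -> f x != f y) (colorable G k).
Proof.
apply: (iffP existsP) => [[f /forallP fP]|[f fP]].
  by exists f => x y exy; apply: (implyP (forallP (fP x) y)).
exists (finfun f); apply/forallP=> x; apply/forallP=> y; apply/implyP=> exy.
by rewrite !ffunE fP.
Qed.

Lemma colorable_cart_prod (G H : sgraph) n m :
  0 < n -> m <= n -> colorable G n -> colorable H m -> colorable (cart_prod G H) n.
Proof.
move=> n0 lemn /colorableP[f fP] /colorableP[g gP]; apply/colorableP.
exists (fun p => Ordinal (ltn_pmod (f p.1 + g p.2) n0)) => -[x h] [y h'].
rewrite /edge /= /cart_edge -val_eqE /= => /orP[/andP[exy /eqP->]|/andP[/eqP-> ehh]].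
  by rewrite eqn_modDr !modn_small // fP.
by rewrite eqn_modDl !modn_small ?gP // (leq_trans (ltn_ord _)).
Qed.

Lemma linkage_bound n : 0 < n -> 3 * (n * (2 * n) ^ (n * n)) < 2 ^ (4 * n ^ 4).
Proof.
move=> n0; have le2n : 2 * n <= 2 ^ n.
  by case: n n0 => // n _; rewrite expnS leq_mul2l ltn_expl.
have lek : (2 * n) ^ (n * n) <= 2 ^ (n ^ 3).
  have -> : n ^ 3 = n * (n * n) by [].
  by rewrite (expnM 2 n) leq_exp2r // muln_gt0 n0.
(* The summands [2], [n] and [n ^ 3] account for the factors [3], [n] and [(2 * n) ^ (n * n)]. *)
apply: (@leq_trans (2 ^ (2 + n + n ^ 3))); last by rewrite leq_exp2l //; nia.
rewrite !expnD.
have := ltn_expl n (isT : 1 < 2); move: lek (expn_gt0 2 (n ^ 3)).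
move: ((2 * n) ^ _) (2 ^ (n ^ 3)) (2 ^ n) => a b c lek b0 ltn; nia.
Qed.

Theorem mainTheorem3 (G H : sgraph)
    (conG : connected G) (conH : connected H)
    (edgeG : exists x y : G, edge x y) (edgeH : exists x y : H, edge x y)
    (chiGH : chromatic_number H <= chromatic_number G)
    (twG : 2 ^ (4 * chromatic_number G ^ 4) <= treewidth G) :
  chromatic_number (cart_prod G H) <= hadwiger_number (cart_prod G H).
Proof.
have [h0 [h1 e01]] := edgeH.
set n := chromatic_number G in chiGH twG.
have colG : colorable G n by rewrite /n /chromatic_number; case: ex_minnP.
have colH : colorable H (chromatic_number H).
  by rewrite /chromatic_number; case: ex_minnP.
(* An edge provides a vertex, whose colour inhabits ['I_n]. *)
have n0 : 0 < n.
  case: edgeG => x _; case/colorableP: colG => f _.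
  exact: leq_ltn_trans (ltn_ord (f x)).
have colGH : chromatic_number (cart_prod G H) <= n.
  rewrite /chromatic_number; case: ex_minnP => m _; apply.
  exact: colorable_cart_prod colG colH.
apply: leq_trans colGH _; rewrite /hadwiger_number; case: ex_maxnP => m _; apply.
apply: minor_of_treewidth e01 _ => //.
exact: leq_trans (linkage_bound n0) twG.
Qed.
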